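(* For every positive integer $s$ and every nonnegative integer $t$ there exists a graph $G$ with $\chi(G)=\omega(G)=s+1$, $i(G)=t$, and $\chi_l(G)=s+t+1$.
   Context: All graphs are finite and simple; $\chi$, $\chi_l$, $\omega$ denote chromatic number, list chromatic number and clique number. A hole of $G$ is an induced cycle of length at least $4$; $G$ is chordal if it has no hole. $\mathcal H(G)$ is the set of holes and $\mathcal H(G,u)$ those containing $u$. A hole cover of $G$ is a nonempty $X\subseteq V(G)$ meeting every hole (any nonempty set if $G$ is chordal). A vertex $u$ satisfies the NC property in $G$ if there are no holes $H\in\mathcal H(G,u)$, $H'\in\mathcal H(G)\setminus\mathcal H(G,u)$ sharing two consecutive edges (two distinct edges with a common end vertex lying on both). A set $\mathcal C$ satisfies the NC property in $G$ if each of its vertices does and every hole contains at most one vertex of $\mathcal C$. Locally chordalizing all holes in $\mathcal H(G,u)$ by $u$ means adding all edges $uw$ with $w\ne u$ lying on some hole in $\mathcal H(G,u)$. For a hole cover $\mathcal C=\{u_1,\dots,u_k\}$ satisfying the NC property in $G$, set $G_0=G$, obtain $G_i$ from $G_{i-1}$ by locally chordalizing all holes in $\mathcal H(G_{i-1},u_i)$ by $u_i$, and put $\widehat G(\mathcal C)=G_k$ (independent of the ordering). Given a hole cover $\mathcal C$ of $G$, an ordered partition $(\mathcal C_1,\dots,\mathcal C_\ell)$ of $\mathcal C$ into nonempty parts is a local chordalization partition if, with $G_0=G_0^*=G-\mathcal C$ and, for $i=1,\dots,\ell$, $G_i$ the graph with $V(G_i)=V(G_{i-1}^* )\cup\mathcal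 C_i$ and $E(G_i)=E(G_{i-1}^* )\cup E\big(G-\bigcup_{j=i+1}^{\ell}\mathcal C_j\big)$ and $G_i^*=\widehat{G_i}(\mathcal C_i)$, each $\mathcal C_i$ is a hole cover of $G_i$ satisfying the NC property in $G_i$ and each $G_i^*$ is chordal. The non-chordality index $i(G)$ is $0$ if $G$ is chordal and otherwise the smallest $\ell$ such that some hole cover of $G$ admits a local chordalization partition with $\ell$ parts. *)

(* Defs.v *)
(* Graphs on a finite type T: a vertex predicate and an
   edge relation (both Prop-valued); adjacency is symmetrised and loop-free,
   so every such record denotes a finite simple graph. *)
From mathcomp Require Import all_boot.
Set Implicit Arguments. Unset Strict Implicit. Unset Printing Implicit Defensive.

Record graph (T : finType) := Graph { gV : T -> Prop ; gE : T -> T -> Prop }.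

Section G.
Variable T : finType.
Implicit Types (G : graph T) (S X C : {set T}).

Definition adj G (x y : T) : Prop :=
  gV G x /\ gV G y /\ x <> y /\ (gE G x y \/ gE G y x).

Definition gdel G X : graph T :=
  Graph (fun x => gV G x /\ x \notin X) (gE G).

Definition is_hole G S : Prop :=
  exists c : seq T, [/\ uniq c, 4 <= size c, (forall x, x \in S <-> x \in c)
     & forall x y, x \in c -> y \in c ->
         (adj G x y <-> (y = next c x \/ x = next c y))].

Definition chordal G : Prop := forall S, ~ is_hole G S.

Definition hole_cover G X : Prop :=
  [/\ X != set0, (forall x, x \in X -> gV G x)
    & forall S, is_hole G S -> exists2 x, x \in X & x \in S].

Definition share_consec G (H H' : {set T}) : Prop :=
  exists a b c : T, [/\ a <> c, adj G a b, adj G b c,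
     [/\ a \in H, b \in H & c \in H] & [/\ a \in H', b \in H' & c \in H']].

Definition NC_vertex G u : Prop :=
  ~ exists H H' : {set T}, [/\ is_hole G H, u \in H, is_hole G H', u \notin H'
                   & share_consec G H H'].

Definition NC_set G C : Prop :=
  (forall u, u \in C -> NC_vertex G u) /\
  (forall S, is_hole G S -> #|S :&: C| <= 1).

Definition lchord G u : graph T :=
  Graph (gV G) (fun x y => adj G x y \/
     (x = u /\ exists H : {set T}, [/\ is_hole G H, u \in H & y \in H])).

(* \hat G(C) computed along the ordering s of C *)
Definition hatG G (s : seq T) : graph T := foldl lchord G s.

Definition ordered_partition (Cs : seq {set T}) C : Prop :=
  [/\ forall X, X \in Cs -> X != set0,
      \bigcup_(X <- Cs) X = C
    & forall i j, i < j < size Cs -> [disjoint nth set0 Cs i & nth set0 Cs j]].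

(* Gs = G_{i-1}^*, the remaining parts C_i, ..., C_l *)
Fixpoint lcp_ok G (Gs : graph T) (Cs : seq {set T}) : Prop :=
  match Cs with
  | [::] => True
  | Ci :: rest =>
      let R := \bigcup_(X <- rest) X in
      let Gi := Graph (fun x => gV Gs x \/ x \in Ci)
                      (fun x y => adj Gs x y \/ adj (gdel G R) x y) in
      let Gis := hatG Gi (enum Ci) in
      [/\ hole_cover Gi Ci, NC_set Gi Ci, chordal Gis & lcp_ok G Gis rest]
  end.

Definition local_chordalization_partition G C (Cs : seq {set T}) : Prop :=
  ordered_partition Cs C /\ lcp_ok G (gdel G C) Cs.

Definition has_lcp_of_size G (l : nat) : Prop :=
  exists C Cs, [/\ hole_cover G C, local_chordalization_partition G C Cs
                 & size Cs = l].

Definition is_min (P : nat -> Prop) (k : nat) : Prop := P k /\ forall j, P j -> k <= j.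
Definition is_max (P : nat -> Prop) (k : nat) : Prop := P k /\ forall j, P j -> j <= k.

Definition nci_is G (t : nat) : Prop :=
  (chordal G /\ t = 0) \/ (~ chordal G /\ is_min (has_lcp_of_size G) t).

Definition colorable G (k : nat) : Prop :=
  exists f : T -> nat, (forall x, gV G x -> f x < k) /\
                       (forall x y, adj G x y -> f x <> f y).
Definition chi_is G k := is_min (colorable G) k.

Definition is_clique G (Q : {set T}) : Prop :=
  (forall x, x \in Q -> gV G x) /\ (forall x y, x \in Q -> y \in Q -> x <> y -> adj G x y).
Definition omega_is G k := is_max (fun j => exists Q, is_clique G Q /\ #|Q| = j) k.

Definition choosable G (k : nat) : Prop :=
  forall L : T -> seq nat, (forall x, gV G x -> k <= size (undup (L x))) ->
    exists f : T -> nat, (forall x, gV G x -> f x \in L x) /\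
                         (forall x y, adj G x y -> f x <> f y).
Definition chil_is G k := is_min (choosable G) k.

End G.

(* Main.v *)
(** Take the complete multipartite graph with [s - 1] singleton parts, one part
    [A] of size [t + 1] and one part [B] consisting of all functions from the
    [k = s + t] remaining vertices to a [k]-set.  It is not [k]-choosable (give
    the [k] vertices outside [B] disjoint lists and the vertices of [B] all
    transversals), but it is greedily [k + 1]-choosable, as [B] is independent.
    Adding the vertices of [A] one by one gives a local chordalization partition
    with [t] parts.  Conversely, if a part of a local chordalization partition
    contains two vertices of the same colour class, then the NC property forces
    the rest of the graph to be complete at that stage; hence there is no hole
    and the two vertices are never joined.  By pigeonhole, fewer than [t] parts
    leave two nonadjacent vertices in each of [A] and [B], hence a hole. *)
Require Import Defs.
From mathcomp Require Import all_boot.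
From mathcomp Require Import zify.
Set Implicit Arguments. Unset Strict Implicit. Unset Printing Implicit Defensive.

(** * Adjacency and holes in arbitrary graphs *)

Section Graphs.
Variable T : finType.
Implicit Types (G : graph T) (S X C : {set T}).

Lemma adj_sym G x y : adj G x y -> adj G y x.
Proof. by move=> [gx [gy [nxy e]]]; split=> //; split=> //; split; [exact: nesym|case: e; auto]. Qed.

Lemma hole_nbr G S x : is_hole G S -> x \in S -> exists2 y, y \in S & adj G x y.
Proof.
move=> [c [uc sc Sc adjc]] /Sc xc; exists (next c x).
  by apply/Sc; rewrite mem_next.
by apply/adjc; rewrite ?mem_next //; left.
Qed.

(** A hole has at least four vertices, so one of them differs from [x] and from both neighbours of
    [x] on the cycle. *)
Lemma hole_nonnbr G S x : is_hole G S -> x \in S ->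
  exists y, [/\ y \in S, x <> y & ~ adj G x y].
Proof.
move=> [c [uc sc Sc adjc]] /Sc xc.
case: (boolP (all (mem [:: x; next c x; prev c x]) c)) => [/allP sub|/allPn[y yc]].
  by have := uniq_leq_size uc sub; rewrite leqNgt sc.
rewrite !inE !negb_or => /and3P[/eqP yx /eqP yn /eqP yp].
exists y; split; [exact/Sc|exact: nesym|move/(adjc _ _ xc yc)].
by case=> // e; apply: yp; rewrite e prev_next.
Qed.

Lemma sub_hole G G' S :
  (forall x y, x \in S -> y \in S -> (adj G x y <-> adj G' x y)) ->
  is_hole G S -> is_hole G' S.
Proof.
move=> e [c [uc sc Sc adjc]]; exists c; split=> // x y xc yc.
by rewrite -(adjc _ _ xc yc); apply: iff_sym; apply: e; apply/Sc.
Qed.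

(** All holes exhibited explicitly below are 4-cycles, given by their cyclic order and two missing
    diagonals. *)
Lemma hole4 G a b c d : a <> c -> b <> d ->
  adj G a b -> adj G b c -> adj G c d -> adj G d a -> ~ adj G a c -> ~ adj G b d ->
  is_hole G [set z in [:: a; b; c; d]].
Proof.
move=> ac bd ab bc cd da nac nbd.
have neq x y : adj G x y -> (x == y) = false by case=> _ [_ [/eqP/negbTE]].
have irr x : ~ adj G x x by case=> _ [_ []].
have [eab ebc ecd eda] : [/\ (a == b) = false, (b == c) = false, (c == d) = false & (d == a) = false].
  by split; apply: neq.
have eac : (a == c) = false by apply/eqP.
have ebd : (b == d) = false by apply/eqP.
have uc : uniq [:: a; b; c; d].
  by rewrite /= !inE eab eac (eq_sym a d) eda ebc ebd ecd.
have [ba cb dc ad] : [/\ adj G b a, adj G c b, adj G d c & adj G a d].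
  by split; apply: adj_sym.
have nca : ~ adj G c a by move/adj_sym.
have ndb : ~ adj G d b by move/adj_sym.
have [na nb nc nd] : [/\ next [:: a; b; c; d] a = b, next [:: a; b; c; d] b = c,
    next [:: a; b; c; d] c = d & next [:: a; b; c; d] d = a].
  rewrite /= !eqxx (eq_sym b a) eab (eq_sym c a) eac (eq_sym c b) ebc.
  by rewrite eda (eq_sym d b) ebd (eq_sym d c) ecd.
exists [:: a; b; c; d]; split=> // [x|x y]; first by rewrite inE.
have [Eab Ebc Ecd Eda] : [/\ a <> b, b <> c, c <> d & d <> a] by split; apply/eqP/negbT.
rewrite !inE; case/or4P=> /eqP->; case/or4P=> /eqP->; rewrite ?na ?nb ?nc ?nd;
  split=> // H; try (by left); try (by right); try (by case: (irr _ H)); by case: H => e; subst.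
Qed.

(** * Effect of local chordalization on adjacency *)

Lemma gV_hatG G s x : gV (hatG G s) x <-> gV G x.
Proof. by elim: s G => //= u s IH G; rewrite IH. Qed.

Lemma adj_lchord G u x y : adj G x y -> adj (lchord G u) x y.
Proof. by move=> h; case: (h) => gx [gy [n _]]; do 3!split=> //; left; left. Qed.

Lemma adj_hatG G s x y : adj G x y -> adj (hatG G s) x y.
Proof. by elim: s G => //= u s IH G h; apply: IH; apply: adj_lchord. Qed.

Lemma adj_lchord_inv G u x y :
  adj (lchord G u) x y -> adj G x y \/ (x = u \/ y = u) /\ ~ chordal G.
Proof.
case=> gx [gy [n]]; case; case.
- by left.
- by case=> -> [H [hH _ _]]; right; split; [left|move/(_ H)].
- by move/adj_sym; left.
- by case=> -> [H [hH _ _]]; right; split; [right|move/(_ H)].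
Qed.

(** Each added edge is incident with the chordalizing vertex, so a later stage never chordally joins
    two vertices already present. *)
Lemma adj_hatG_inv G s x y :
  adj (hatG G s) x y -> adj G x y \/ x \in s \/ y \in s.
Proof.
elim: s G => [|u s IH] G /=; first by left.
case/IH; last by case=> h; right; rewrite !inE h orbT; [left|right].
case/adj_lchord_inv; first by left.
by case; case=> -> _; right; rewrite !inE eqxx; [left|right].
Qed.

(** Without holes a chordalization step adds no edge, so the graph is still chordal at the next
    step. *)
Lemma adj_hatG_chordal G s x y : chordal G -> adj (hatG G s) x y -> adj G x y.
Proof.
elim: s G => //= u s IH G cG.
have e v w : adj (lchord G u) v w <-> adj G v w.
  by split; [case/adj_lchord_inv=> // -[]|exact: adj_lchord].
move/(IH _ _)=> h; apply/e; apply: h => S hS; apply: (cG S).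
by apply: sub_hole hS => v w _ _; apply: e.
Qed.

(** * Bounds on colourings and greedy choices from lists *)

Lemma clique_leq G Q k : is_clique G Q -> colorable G k -> #|Q| <= k.
Proof.
move=> [VQ adjQ] [f [fk fadj]].
have injf : {in Q &, injective f}.
  move=> x y xQ yQ e; case: (eqVneq x y) => // /eqP n.
  by case: (fadj x y (adjQ _ _ xQ yQ n)).
rewrite cardE -(size_map f) -(size_iota 0 k); apply: uniq_leq_size.
  by rewrite map_inj_in_uniq ?enum_uniq // => x y; rewrite !mem_enum; apply: injf.
move=> _ /mapP[x xQ ->]; rewrite mem_iota /=; apply/fk/VQ.
by rewrite -mem_enum.
Qed.

Lemma fresh (l s : seq nat) : size s < size (undup l) -> exists2 x, x \in l & x \notin s.
Proof.
move=> lt; case: (boolP (all (mem s) (undup l))) => [/allP sub|/allPn[x]].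
  by have := uniq_leq_size (undup_uniq l) sub; rewrite leqNgt lt.
by rewrite mem_undup; exists x.
Qed.

(** Colours are picked one vertex at a time; fewer are taken at each point than the next list
    offers. *)
Lemma greedy_system (I : eqType) (L : I -> seq nat) (xs : seq I) :
  (forall x, size xs <= size (undup (L x))) -> uniq xs ->
  exists f : I -> nat, {in xs, forall x, f x \in L x} /\ {in xs &, injective f}.
Proof.
elim: xs => [|x xs IH] /= sz; first by exists (fun=> 0).
case/andP=> xxs uxs; case: IH => // [y|f [fL fi]]; first exact: ltnW.
have [|c cL cf] := @fresh (L x) (map f xs); first by rewrite size_map.
have nx y : y \in xs -> (y == x) = false by move=> yxs; apply: contraNF xxs => /eqP<-.
have cN y : y \in xs -> c <> f y by move=> yxs e; rewrite e map_f in cf.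
exists (fun y => if y == x then c else f y); split=> [y|y z]; rewrite !inE.
  by case: eqP => [->|_] //=; apply: fL.
case: eqP => [->|_] /=; case: eqP => [->|_] //= ys zs.
- by move/(cN _ zs).
- by move/esym/(cN _ ys).
- exact: fi.
Qed.

End Graphs.

(** * Complete multipartite graphs: lower bound on the number of parts *)

Definition multipartite (T : finType) (p : T -> nat) : graph T :=
  Graph (fun=> True) (fun x y => p x <> p y).

Section Multipartite.
Variables (T : finType) (p : T -> nat).
Local Notation G := (multipartite p).

Lemma adj_multipartite x y : adj G x y <-> p x <> p y.
Proof.
split; first by case=> _ [_ [_ []]] // /nesym.
by move=> n; do 3!split=> //; [move=> e; apply: n; rewrite e|left].
Qed.

(** Induction over the remaining parts, with [Gs] the chordal graph reached so far and [F] the final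
    one. The third clause carries the fourth through the induction: two vertices of one class that
    are nonadjacent once present stay nonadjacent, since later stages add edges inside a class only
    at new vertices. *)
Lemma lcp_ok_multipartite (Cs : seq {set T}) (Gs : graph T) :
  (forall i j, i < j < size Cs -> [disjoint nth set0 Cs i & nth set0 Cs j]) ->
  lcp_ok G Gs Cs -> chordal Gs ->
  (forall x, gV Gs x <-> x \notin \bigcup_(X <- Cs) X) ->
  (forall x y, x \notin \bigcup_(X <- Cs) X -> y \notin \bigcup_(X <- Cs) X ->
     p x <> p y -> adj Gs x y) ->
  exists F : graph T,
  [/\ chordal F, forall x y, p x <> p y -> adj F x y,
    forall x y, x \notin \bigcup_(X <- Cs) X -> y \notin \bigcup_(X <- Cs) X ->
      p x = p y -> ~ adj Gs x y -> ~ adj F x y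
  & forall X x y, X \in Cs -> x \in X -> y \in X -> x <> y -> p x = p y -> ~ adj F x y].
Proof.
elim: Cs Gs => [|Ci rest IH] Gs dis.
  move=> _ cGs _ aGs; exists Gs; split=> // x y n.
  by apply: aGs; rewrite // big_nil inE.
rewrite big_cons; set R := \bigcup_(X <- rest) X => ok cGs vGs aGs.
have disR x : x \in Ci -> x \notin R.
  move=> xC; rewrite /R; apply/negP => xR.
  have [X Xr xX] : exists2 X, X \in rest & x \in X.
    move: xR; elim: (rest) => [|Y r IHr]; first by rewrite big_nil inE.
    rewrite big_cons inE => /orP[xY|/IHr[X Xr xX]]; first by exists Y; rewrite ?mem_head.
    by exists X; rewrite // inE Xr orbT.
  have := dis 0 (index X rest).+1; rewrite /= ltnS index_mem nth_index // => /(_ Xr).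
  by move/disjointFr => /(_ _ xC); rewrite xX.
case: ok; rewrite -/R.
set Gi := Graph _ _; set F := hatG Gi _ => _ [_ nc] cF okF.
have vGi x : gV Gi x <-> x \notin R.
  rewrite /= vGs inE negb_or; split; first by case=> [/andP[]|/disR].
  by move=> ->; rewrite andbT; case: (x \in Ci); [right|left].
have adjGi x y : p x <> p y -> x \notin R -> y \notin R -> adj Gi x y.
  move=> n xR yR; split; [exact/vGi|split; [exact/vGi|split]].
    by move=> e; apply: n; rewrite e.
  left; right; do 3!split=> //; first by move=> e; apply: n; rewrite e.
  by left.
(* [G] has no edge inside a class, so there [Gi] takes its edges from [Gs] alone. *)
have adjGi_inv x y : p x = p y -> adj Gi x y -> adj Gs x y.
  have aux u v : adj Gs u v \/ adj (gdel G R) u v -> p u = p v -> adj Gs u v.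
    by case=> // -[_ [_ [_ [] /= h]]] e; case: h.
  by move=> e [_ [_ [_ [/aux/(_ e)|/aux/(_ (esym e))/adj_sym]]]].
have CiGs x y : x \in Ci -> ~ adj Gs x y.
  by move=> xC [/vGs]; rewrite inE xC.
have vF x : gV F x <-> x \notin R by rewrite gV_hatG.
have aF x y : x \notin R -> y \notin R -> p x <> p y -> adj F x y.
  by move=> xR yR n; apply: adj_hatG; apply: adjGi.
have disrest i j : i < j < size rest -> [disjoint nth set0 rest i & nth set0 rest j].
  exact: (dis i.+1 j.+1).
have [F' [cF' aF' nF' sF']] := IH F disrest okF cF vF aF.
exists F'; split=> // [x y|X x y].
  rewrite !inE !negb_or => /andP[xC xR] /andP[yC yR] e n.
  apply: nF' => // /adj_hatG_inv; rewrite !mem_enum (negbTE xC) (negbTE yC).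
  by case=> [/(adjGi_inv _ _ e)//|[]].
rewrite inE => /orP[/eqP-> xC yC n e|]; last exact: sF'.
apply: nF' => //; try exact: disR.
have nxy : ~ adj Gi x y by move/(adjGi_inv _ _ e); exact: CiGs.
(* If [Gi] is chordal, [hatG] adds nothing and [x], [y] stay nonadjacent. *)
suff cGi : chordal Gi by move/(adj_hatG_chordal cGi).
(* A missing edge outside the class of [x] and [y] would close a 4-hole through both. *)
have full v w : p v <> p x -> p w <> p x -> v \notin R -> w \notin R ->
    v <> w -> ~ ~ adj Gi v w.
  move=> nv nw vR wR nvw navw.
  have hS : is_hole Gi [set z in [:: x; v; y; w]].
    apply: hole4 => //; apply: adjGi; rewrite -?e //; try exact: disR; exact: nesym.
  have := nc _ hS; rewrite leqNgt => /negP; apply.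
  have <- : #|[set x; y]| = 2 by rewrite cards2; case: eqP n.
  apply/subset_leq_card/subsetP => z; rewrite !inE => /orP[]/eqP->.
    by rewrite eqxx xC.
  by rewrite eqxx yC !orbT.
move=> S hS.
have SR z : z \in S -> z \notin R.
  by move=> zS; have [w _ [/vGi]] := hole_nbr hS zS.
(* A vertex of the hole outside the class of [x] would be adjacent to all the others. So the hole
   lies in one class, where [Gi] agrees with the chordal [Gs]. *)
have Sp z : z \in S -> p z = p x.
  move=> zS; case: (eqVneq (p z) (p x)) => // /eqP nz.
  have [w [wS nzw nadj]] := hole_nonnbr hS zS.
  case: (eqVneq (p w) (p x)) => [ew|/eqP nw].
    by case: nadj; apply: adjGi; rewrite ?ew //; apply: SR.
  by case: (@full z w) => //; apply: SR.
apply: (cGs S); apply: sub_hole hS => v w vS wS.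
have evw : p v = p w by rewrite !Sp.
split; first exact: adjGi_inv.
move=> h; split; first exact/vGi/SR.
split; first exact/vGi/SR.
by split; [case: h => _ [_ []]|left; left].
Qed.

Lemma lcp_multipartite_size l (A B : {set T}) a b :
  has_lcp_of_size G l -> a <> b ->
  (forall x, x \in A -> p x = a) -> (forall x, x \in B -> p x = b) ->
  l.+1 < #|A| -> l.+1 < #|B| -> False.
Proof.
move=> [C [Cs [[_ _ covC] [[ne CsC dis] ok] sz]]] nab Aa Bb ltA ltB.
have vG x : gV (gdel G C) x <-> x \notin \bigcup_(X <- Cs) X.
  by rewrite CsC; split=> [[]|].
have aG x y : x \notin \bigcup_(X <- Cs) X -> y \notin \bigcup_(X <- Cs) X ->
    p x <> p y -> adj (gdel G C) x y.
  rewrite CsC => xC yC n; do 3!split=> //; last by left.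
  by move=> e; apply: n; rewrite e.
have adjC x y : adj (gdel G C) x y -> [/\ x \notin C, y \notin C & adj G x y].
  by case=> -[_ xC] [[_ yC] [n e]].
have cG : chordal (gdel G C).
  move=> S hS; have SC x : x \in S -> x \notin C.
    by move=> xS; have [y _ /adjC[]] := hole_nbr hS xS.
  have [|x xC /SC] := covC S; last by rewrite xC.
  apply: sub_hole hS => x y xS yS; split; first by case/adjC.
  by case=> _ [_ h]; split; [split=> //; exact: SC|split=> //; split=> //; exact: SC].
have [F [cF aF nF sF]] := lcp_ok_multipartite dis ok cG vG aG.
have pair (A' : {set T}) c : (forall x, x \in A' -> p x = c) -> l.+1 < #|A'| ->
    exists x y, [/\ x \in A', y \in A', x <> y & ~ adj F x y].
  (* [find] returns [size Cs] on a vertex in no part, so [cl] has at most [l + 1] values, the last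
     one standing for vertices outside the cover. *)
  move=> Ac lt; pose cl x := find (fun X : {set T} => x \in X) Cs.
  have ltcl x : cl x < l.+1 by rewrite ltnS -sz find_size.
  have /injectivePn[[x xA] [[y yA] nxy /= e]] :
      ~~ injectiveb (fun x : {x | x \in A'} => Ordinal (ltcl (val x))).
    apply/negP=> /injectiveP /leq_card; rewrite card_ord card_sig leqNgt.
    by rewrite (_ : #|_| = #|A'|) ?lt //; apply: eq_card.
  have {}nxy : x <> y by move=> exy; case/eqP: nxy; apply: val_inj.
  have {}e : cl x = cl y by case: e.
  exists x, y; split=> //.
  have pe : p x = p y by rewrite !Ac.
  case: (boolP (has (fun X : {set T} => x \in X) Cs)) => hx.
    apply: (sF (nth set0 Cs (cl x))) => //.
    - by rewrite mem_nth // -has_find.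
    - exact: (nth_find set0 hx).
    - by rewrite e; apply: (@nth_find _ set0 (fun X => y \in X)); rewrite has_find -/(cl y) -e -has_find.
  have out z : cl z = cl x -> z \notin \bigcup_(X <- Cs) X.
    move=> ez; have : ~~ has (fun X : {set T} => z \in X) Cs.
      by rewrite has_find -/(cl z) ez -has_find.
    elim: (Cs) => [|X r IHr] /=; first by rewrite big_nil inE.
    by rewrite big_cons inE !negb_or => /andP[-> /IHr].
  apply: nF; rewrite ?out // => /adjC[_ _ /adj_multipartite]; exact.
have [x [y [xA yA nxy axy]]] := pair A a Aa ltA.
have [v [w [vB wB nvw avw]]] := pair B b Bb ltB.
have [[px py] [pv pw]] := ((Aa x xA, Aa y yA), (Bb v vB, Bb w wB)).
(* The two nonadjacent pairs are the diagonals of a 4-hole in the chordal graph [F]. *)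
apply: (cF _ (hole4 nxy nvw _ _ _ _ axy avw)); apply: aF;
  rewrite ?px ?py ?pv ?pw //; exact: nesym.
Qed.

End Multipartite.

(** * The witness graph, its chromatic number and its clique number *)

Section Witness.
(* Here [s] stands for the [s - 1] of the theorem. *)
Variables s t : nat.
Local Notation k := (s + t).+1.
Local Notation T := ('I_k + {ffun 'I_k -> 'I_k})%type.

(** The minimum makes the indices below [s] singleton classes and merges [s, ..., s + t] into class
    [s], of size [t + 1]; the functions form class [s + 1]. *)
Definition part (x : T) : nat := if x is inl i then minn i s else s.+1.
Local Notation G := (multipartite part).

Definition small (x : T) : bool := if x is inl _ then true else false.
Definition idx (x : T) : nat := if x is inl i then val i else 0.

Lemma witness_colorable : colorable G s.+2.
Proof.
exists part; split=> [[i|f] _ /=|x y /adj_multipartite//]; lia.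
Qed.

Lemma witness_clique : exists Q, is_clique G Q /\ #|Q| = s.+2.
Proof.
(* One representative per class; the identity is an arbitrary choice among the functions. *)
pose h (j : 'I_s.+2) : T := if j <= s then inl (inord j) else inr [ffun i => i].
have ph j : part (h j) = j.
  rewrite /h; case: leqP => /= lj; last by have := ltn_ord j; lia.
  by rewrite inordK; lia.
have hi : injective h by move=> i j /(congr1 part); rewrite !ph => /val_inj.
exists (h @: setT); split; last by rewrite card_imset // cardsT card_ord.
split=> // _ _ /imsetP[i _ ->] /imsetP[j _ ->] n; apply/adj_multipartite.
by rewrite !ph => /val_inj e; apply: n; rewrite e.
Qed.

Lemma witness_chi : chi_is G s.+2.
Proof.
split; first exact: witness_colorable.
by have [Q [cQ <-]] := witness_clique => j; apply: clique_leq.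
Qed.

Lemma witness_omega : omega_is G s.+2.
Proof.
split; first exact: witness_clique.
by move=> j [Q [cQ <-]]; apply: clique_leq cQ witness_colorable.
Qed.

(** * The list chromatic number of the witness *)

Lemma witness_not_choosable j : j <= k -> ~ choosable G j.
Proof.
move=> jk ch.
(* Blocks of [k] consecutive integers serve as disjoint lists; [f] names the transversal with offset
   [f i] in block [i]. *)
pose L (x : T) : seq nat := match x with
  | inl i => iota (i * k) k
  | inr f => map (fun i : 'I_k => i * k + f i) (enum 'I_k) end.
have [|g [gL gadj]] := ch L.
  case=> [i|f] _; rewrite /L; first by rewrite undup_id ?iota_uniq ?size_iota.
  rewrite undup_id; first by rewrite size_map size_enum_ord.
  rewrite map_inj_uniq ?enum_uniq // => i i' e; apply: val_inj => /=.
  (* Division by [k] recovers the block, so the entries of a transversal are distinct. *)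
  have := congr1 (divn^~ k) e; rewrite /= !divnMDl // !divn_small ?ltn_ord //; lia.
(* The offsets of the chosen colours in their blocks: the list of [inr f] then consists exactly of
   the colours used on the [inl] vertices. *)
pose f : {ffun 'I_k -> 'I_k} := [ffun i : 'I_k => inord (g (inl i) - i * k)].
have /mapP[i _ e] := gL (inr f) I.
have := gL (inl i) I; rewrite /L mem_iota => /andP[lo hi].
apply: (gadj (inl i) (inr f)).
  by apply/adj_multipartite; rewrite /part; have := geq_minr i s; lia.
rewrite e ffunE inordK; first by rewrite subnKC.
by rewrite ltn_subLR.
Qed.

Lemma witness_choosable : choosable G k.+1.
Proof.
move=> L Lsz; have [||g [gL gi]] := @greedy_system 'I_k (fun i => L (inl i)) (enum 'I_k).
- by move=> i; rewrite size_enum_ord; apply/ltnW/Lsz.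
- exact: enum_uniq.
pose used := [seq g i | i <- enum 'I_k].
(* The default [0] of [head] is never reached: [cB] shows that the filtered list is nonempty. *)
pose c (x : T) := match x with
  | inl i => g i
  | inr _ => head 0 [seq z <- L x | z \notin used] end.
have cB f : c (inr f) \in [seq z <- L (inr f) | z \notin used].
  have [|z zL zu] := @fresh (L (inr f)) used; first by rewrite size_map size_enum_ord; exact: Lsz.
  rewrite /c; have : z \in [seq z <- L (inr f) | z \notin used] by rewrite mem_filter zu.
  by case: [seq _ <- _ | _] => //= w r _; rewrite mem_head.
have cAB i f : c (inl i) <> c (inr f).
  move=> e; have := cB f; rewrite mem_filter -e => /andP[/negP[]].
  by apply/map_f; rewrite mem_enum.
exists c; split=> [[i|f] _|[i|f] [i'|f'] /adj_multipartite //= n].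
- by apply: gL; rewrite mem_enum.
- by have := cB f; rewrite mem_filter => /andP[].
- by move/gi; rewrite !mem_enum => /(_ isT isT) e; apply: n; rewrite e.
- exact: cAB.
- exact/nesym/cAB.
Qed.

Lemma witness_chil : chil_is G k.+1.
Proof.
split; first exact: witness_choosable.
by move=> j; case: (leqP j k) => // jk /(witness_not_choosable jk).
Qed.

(** * A local chordalization partition of the witness with [t] parts *)

(** No vertex of a hole is adjacent to all the others, so the hole would consist of [inr] vertices
    only; these are independent, while a hole has edges. *)
Lemma small_dominating_chordal (F : graph T) :
  (forall f g, ~ adj F (inr f) (inr g)) -> forall S : {set T},
  (forall i y, inl i \in S -> y \in S -> inl i <> y -> adj F (inl i) y) -> ~ is_hole F S.
Proof.
move=> ind S dom hS.
have noS i : inl i \notin S.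
  by apply/negP => iS; have [y [yS n]] := hole_nonnbr hS iS; apply; apply: dom.
have [x xS] : exists x, x \in S.
  case: hS => [[|x c] [_ _ Sc _]] //; by exists x; apply/Sc; rewrite mem_head.
have [y yS] := hole_nbr hS xS.
case: x xS => [i|f] xS; first by case/negP: (noS i).
case: y yS => [i|g] yS; first by case/negP: (noS i).
exact: ind.
Qed.

Definition present m (x : T) : bool := if x is inl i then i < m else true.

(** A complete split graph: the first [m] vertices [inl i] form a clique joined to the independent
    set of all functions. *)
Definition stage_adj m (x y : T) : Prop :=
  [/\ present m x, present m y, x <> y & small x || small y].

Definition stage_parts m n : seq {set T} := [seq [set inl (inord j)] | j <- iota m n].

Lemma mem_stage_parts m n x : m + n = k ->
  (x \in \bigcup_(X <- stage_parts m n) X) = ~~ present m x.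
Proof.
elim: n m => [|n IH] m e; rewrite /stage_parts /=.
  by rewrite big_nil inE; case: x => [i|f] //=; rewrite -e addn0 in i *; rewrite ltn_ord.
rewrite big_cons inE IH; last by rewrite addSnnS.
rewrite {IH}inE; case: x => [i|f] //; rewrite (inj_eq inl_inj) /=.
case: eqP => [->|n'] /=; first by rewrite inordK ?ltnn //; lia.
rewrite -!leqNgt ltn_neqAle; case: eqP => // e'; case: n'.
by rewrite e' inord_val.
Qed.

(** Adding [u], of index [m], to stage [m] gives stage [m + 1] without the edges from [u] to its own
    class. Every hole passes through [u], and chordalizing by [u] fills in exactly these edges. *)
Lemma stage_lcp_ok n m (Gs : graph T) : 0 < t -> m + n = k -> s < m ->
  (forall x, gV Gs x <-> present m x) -> (forall x y, adj Gs x y <-> stage_adj m x y) ->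
  lcp_ok G Gs (stage_parts m n).
Proof.
move=> t0; elim: n m Gs => [//|n IH] m Gs e sm vGs aGs /=.
have lm : m < k by lia.
set u : T := inl (inord m).
have e' : m.+1 + n = k by rewrite addSnnS.
set R := \bigcup_(X <- _) X.
have memR x : (x \in R) = ~~ present m.+1 x by apply: mem_stage_parts.
set Gi := Graph _ _.
have presS x : present m.+1 x = present m x || (x == u).
  case: x => [i|f] //=; rewrite /u ltnS leq_eqVlt orbC; congr (_ || _).
  by rewrite (inj_eq inl_inj) -(inj_eq val_inj) /= inordK.
have vGi x : gV Gi x <-> present m.+1 x.
  rewrite presS /= inE vGs; split; [by case=> ->; rewrite ?orbT|by case/orP; auto].
have npu : present m u = false by rewrite /= inordK // ltnn.
have aGi x y : adj Gi x y <->
    stage_adj m.+1 x y /\ (part x <> part y \/ x <> u /\ y <> u).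
  have aux v w : adj Gs v w \/ adj (gdel G R) v w ->
      (small v || small w) /\ (part v <> part w \/ v <> u /\ w <> u).
    case=> [/aGs[pv pw _ svw]|[_ [_ [_ h]]]].
      by split=> //; right; split=> h; rewrite ?h npu in pv pw.
    have nvw : part v <> part w by case: h => // /nesym.
    by split; [case: (v) (w) nvw => [?|?] [?|?]|left].
  split=> [[/vGi px [/vGi py [nxy h]]]|[[px py nxy sxy] h]].
    have [sxy h'] : (small x || small y) /\ (part x <> part y \/ x <> u /\ y <> u).
      case: h => /aux [] //; rewrite orbC => sxy h'; split=> //.
      by case: h' => [/nesym|[]]; auto.
    by split.
  split; [exact/vGi|split; [exact/vGi|split=> //; left]].
  case: (eqVneq (part x) (part y)) => [ep|/eqP np].
    left; apply/aGs; case: h => // -[/eqP xu /eqP yu]; split=> //.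
      by move: px; rewrite presS (negbTE xu) orbF.
    by move: py; rewrite presS (negbTE yu) orbF.
  right; split; [by split; rewrite ?memR ?px|split; [by split; rewrite ?memR ?py|]].
  by split=> //; left.
(* Away from [u] the present [inl] vertices are adjacent to everything, which excludes holes. *)
have holeu S : is_hole Gi S -> u \in S.
  move=> hS; apply/negPn/negP=> uS.
  have SV z : z \in S -> present m.+1 z.
    by move=> zS; have [w _ [/vGi]] := hole_nbr hS zS.
  apply: (small_dominating_chordal _ _ hS) => [f g|i y iS yS n'].
    by case/aGi=> -[].
  apply/aGi; split; first by split=> //; apply: SV.
  by right; split=> h; rewrite -h ?iS ?yS in uS.
rewrite enum_set1 /=.
have aGis x y : adj (lchord Gi u) x y <-> stage_adj m.+1 x y.
  split.
    case=> /vGi px [/vGi py [n']].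
    have aux v w : adj Gi v w \/ (v = u /\ exists H : {set T}, [/\ is_hole Gi H, u \in H & w \in H]) ->
        small v || small w.
      by case=> [/aGi[[]]|[-> _]].
    by case=> /aux h; split=> //; rewrite orbC.
  (* Since [t > 0] gives [k >= 2], two constant functions differ. *)
  have f0 : exists f g : {ffun 'I_k -> 'I_k}, f <> g.
    exists [ffun=> ord0], [ffun=> ord_max] => /ffunP/(_ ord0); rewrite !ffunE.
    by move/(congr1 val) => /=; lia.
  have half x' y' : x' = u -> stage_adj m.+1 x' y' -> adj (lchord Gi u) x' y'.
    move=> -> {x'} [px' py' n' _].
    case: (eqVneq (part u) (part y')) => [ep|/eqP np].
      have [f [g nfg]] := f0.
      have sy : part y' = s by rewrite -ep /= inordK; lia.
      have pu : part u = s by rewrite ep.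
      (* A vertex [y'] in the class of [u] is opposite to [u] in a 4-hole through two functions, so
         chordalizing joins the two. *)
      have hS : is_hole Gi [set z in [:: u; inr f; y'; inr g]].
        case: y' n' py' ep sy => [i|//] n' py' ep sy; [|by rewrite /=; lia].
        apply: hole4 => //; try by case.
        all: try (apply/aGi; split; [by split|left; rewrite ?pu ?sy /=; lia]).
        - by case/aGi=> _ [|[]].
        - by case/aGi=> -[].
      split; [exact/vGi|split; [exact/vGi|split=> //; left; right; split=> //]].
      by exists [set z in [:: u; inr f; y'; inr g]]; rewrite !inE !eqxx !orbT.
    by apply/adj_lchord/aGi; split; [split|left].
  move=> h; case: (eqVneq x u) => [xu|/eqP xu]; first exact: half.
  case: (eqVneq y u) => [yu|/eqP yu].
    apply/adj_sym/half => //; case: h => px py n' sxy; split=> //; first exact: nesym.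
    by rewrite orbC.
  by apply/adj_lchord/aGi; split=> //; right.
split.
- split; first by apply/set0Pn; exists u; rewrite inE.
    by move=> x; rewrite inE => /eqP->; apply/vGi; rewrite presS eqxx orbT.
  by move=> S /holeu uS; exists u; rewrite ?inE.
(* The NC property of [u] is vacuous, as no hole avoids [u]. *)
- split=> [x|S _]; last by rewrite -(cards1 u) subset_leq_card // subsetIr.
  by rewrite inE => /eqP-> [H [H' [_ _ /holeu -> ]]].
- move=> S hS; apply: (small_dominating_chordal _ _ hS) => [f g|i y iS yS n'].
    by case/aGis.
  have SV z : z \in S -> present m.+1 z.
    by move=> zS; have [w _ /aGis[]] := hole_nbr hS zS.
  by apply/aGis; split=> //; apply: SV.
- by apply: IH => //; lia.
Qed.

(** For [t = 0] the [inl] vertices all lie in different classes, so the graph is complete split. *)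
Lemma witness_chordal : t = 0 -> chordal G.
Proof.
move=> t0 S; apply: small_dominating_chordal => [f g /adj_multipartite//|i y _ _ n].
apply/adj_multipartite; case: y n => [j|f] /= n; have := ltn_ord i; last by lia.
have := ltn_ord j => lj li e; apply: n; congr inl; apply: val_inj => /=; lia.
Qed.

Lemma witness_large_parts : exists A B : {set T},
  [/\ forall x, x \in A -> part x = s, forall x, x \in B -> part x = s.+1,
      t < #|A| & t < #|B|].
Proof.
pose a (j : 'I_t.+1) : T := inl (inord (s + j)).
(* The constant functions alone give [k > t] vertices of the last class. *)
pose b (i : 'I_k) : T := inr [ffun=> i].
have pa j : idx (a j) = s + j by rewrite /= inordK //; have := ltn_ord j; lia.
exists (a @: setT), (b @: setT); split.
- by move=> _ /imsetP[j _ ->]; have := pa j => /= ->; lia.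
- by move=> _ /imsetP[j _ ->].
- rewrite card_imset ?cardsT ?card_ord // => i j /(congr1 idx); rewrite !pa => /addnI.
  exact: val_inj.
- rewrite card_imset ?cardsT ?card_ord; first by lia.
  by move=> i j [] /ffunP/(_ ord0); rewrite !ffunE.
Qed.

(** Keeping only index [s] of its class leaves a complete split graph, to which [s + 1, ..., s + t]
    are added back one at a time. *)
Lemma witness_has_lcp : 0 < t -> has_lcp_of_size G t.
Proof.
move=> t0; have ek : s.+1 + t = k by [].
exists (\bigcup_(X <- stage_parts s.+1 t) X), (stage_parts s.+1 t).
set C := \bigcup_(X <- _) X.
have memC x : (x \in C) = ~~ present s.+1 x by apply: mem_stage_parts.
split; last by rewrite size_map size_iota.
- split=> //.
    by apply/set0Pn; exists (inl ord_max); rewrite memC /=; lia.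
  move=> S hS; case: (boolP [exists x in C, x \in S]).
    by case/existsP=> x /andP[xC xS]; exists x.
  rewrite negb_exists => /forallP nS; exfalso.
  have SV z : z \in S -> present s.+1 z.
    by move=> zS; have := nS z; rewrite memC zS andbT negbK.
  apply: (small_dominating_chordal _ _ hS) => [f g /adj_multipartite//|i y iS yS n].
  apply/adj_multipartite; have := SV _ iS; have := SV _ yS.
  case: y yS n => [j|f] yS n /= lj li; last by lia.
  by move=> e; apply: n; congr inl; apply: val_inj => /=; lia.
- split; first split=> //.
  + by move=> X /mapP[j _ ->]; apply/set0Pn; exists (inl (inord j)); rewrite inE.
  + move=> i j; rewrite size_map size_iota => /andP[ij jt].
    rewrite !(nth_map 0) ?size_iota ?nth_iota //; try lia.
    rewrite disjoints1 inE; apply/eqP=> -[] /(congr1 val) /=.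
    by rewrite !inordK; lia.
  apply: stage_lcp_ok => // [x|x y] /=.
    by rewrite memC negbK; split=> [[]|].
  split.
    case=> -[_]; rewrite memC negbK => px [[_]]; rewrite memC negbK => py [n h].
    split=> //; have : part x <> part y by case: h => // /nesym.
    by case: (x) (y) => [?|?] [?|?].
  case=> px py n sxy; split; first by rewrite /= memC px.
  split; first by rewrite /= memC py.
  split=> //; left=> /= e; apply: n; case: x y px py sxy e => [i|f] [j|g] //= *; try lia.
  by congr inl; apply: val_inj => /=; lia.
Qed.

(** * The non-chordality index of the witness, and the conclusion *)

Lemma witness_nci : nci_is G t.
Proof.
case: (posnP t) => [t0|t0]; first by left; split=> //; apply: witness_chordal.
have [A [B [pA pB ltA ltB]]] := witness_large_parts.
have ns : s <> s.+1 by lia.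
right; split.
  have two (X : {set T}) : t < #|X| -> exists x y, [/\ x \in X, y \in X & x <> y].
    move=> ltX; have : 1 < #|X| by lia.
    by case/card_gt1P=> x [y [xX yX /eqP n]]; exists x, y.
  have [x [y [xA yA nxy]]] := two A ltA.
  have [v [w [vB wB nvw]]] := two B ltB.
  have [[px py] [pv pw]] := ((pA x xA, pA y yA), (pB v vB, pB w wB)).
  move=> c; apply: (c [set z in [:: x; v; y; w]]); apply: hole4 => //;
    try (by apply/adj_multipartite; rewrite ?px ?py ?pv ?pw; lia).
split; first exact: witness_has_lcp.
(* With [j < t] parts, [j + 1] is at most [t], hence below both class sizes, as the pigeonhole bound
   requires. *)
move=> j hj; rewrite leqNgt; apply/negP => jt.
exact: (lcp_multipartite_size hj ns pA pB (leq_ltn_trans jt ltA) (leq_ltn_trans jt ltB)).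
Qed.

End Witness.

Theorem theorem4p5 (s t : nat) : 0 < s ->
  exists (T : finType) (G : graph T),
    [/\ chi_is G s.+1, omega_is G s.+1, nci_is G t & chil_is G (s + t).+1].
Proof.
case: s => // s _; exists ('I_(s + t).+1 + {ffun 'I_(s + t).+1 -> 'I_(s + t).+1})%type.
exists (multipartite (@part s t)); split.
- exact: witness_chi.
- exact: witness_omega.
- exact: witness_nci.
- exact: witness_chil.
Qed.
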